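(* Let $(X,q)$ be a right-bounded finite-dimensional asymmetric normed space, let $\theta_q=\{x\in X:q(x)=0\}$ and let $\langle\theta_q\rangle$ be its linear span. Then $(X,q)$ is linearly homeomorphic to $\langle\theta_q\rangle\times Z$, where $Z$ is a linear subspace of $(X,q)$ which is Euclidean (i.e. $Z$, with the topology induced by $q$, is linearly homeomorphic to some $\mathbb{R}^k$ with its usual topology) and which is linearly homeomorphic to $X/\langle\theta_q\rangle$.
   Context: An asymmetric norm on a real vector space $X$ is a function $q:X\to[0,\infty)$ such that $q(ax)=aq(x)$ for all $a\ge 0$, $q(x+y)\le q(x)+q(y)$, and $q(x)=q(-x)=0$ implies $x=0$. The pair $(X,q)$ is an asymmetric normed space; its topology is generated by the open balls $B_q(x,\epsilon)=\{y\in X: q(y-x)<\epsilon\}$. The associated norm is $q^s(x)=\max\{q(x),q(-x)\}$, with open balls $B_{q^s}(x,\epsilon)$. The space $(X,q)$ is right-bounded if there exists $r>0$ such that $B_q(0,1)\subseteq B_{q^s}(0,r)+\theta_q$. Finite-dimensional means finite-dimensional as a vector space. Linear subspaces carry the restriction of $q$; products of asymmetric normed spaces $(X_1,q_1)$, $(X_2,q_2)$ carry the asymmetric norm $\max\{q_1(x_1),q_2(x_2)\}$ (which induces the product topology). For a linear subspace $Y$ of $X$, the quotient $X/Y$ carries the topology induced by the asymmetric seminorm $w_Y(x+Y)=\inf\{q(x+y):y\in Y\}$ (generated by the balls $\{u: w_Y(u-v)<\epsilon\}$), which coincides with the quotient topology. ''Linearly homeomorphic'' means that there is a linear bijection which is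 a homeomorphism. *)

(* Defs.v *)
From HB Require Import structures.
From mathcomp Require Import all_boot all_order all_algebra.
From mathcomp Require Import generic_quotient ring_quotient.
From mathcomp Require Import all_classical all_reals all_analysis.

Set Implicit Arguments.
Unset Strict Implicit.
Unset Printing Implicit Defensive.

Import Order.TTheory GRing.Theory Num.Theory.
Import numFieldNormedType.Exports.

Local Open Scope classical_set_scope.
Local Open Scope ring_scope.
Local Open Scope quotient_scope.

Section AsymNorm.
Context {R : realType} {V : lmodType R}.
Implicit Type q : V -> R.

Record asym_norm q : Prop := AsymNorm {
  asym_norm_ge0 : forall x, 0 <= q x;
  asym_normZ : forall a x, 0 <= a -> q (a *: x) = a * q x;
  asym_normD : forall x y, q (x + y) <= q x + q y;
  asym_norm_eq0 : forall x, q x = 0 -> q (- x) = 0 -> x = 0 }.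

Definition asym_ball q (x : V) (e : R) : set V := [set y | q (y - x) < e].

Definition sym_norm q (x : V) : R := Num.max (q x) (q (- x)).

Definition theta q : set V := [set x | q x = 0].

Definition right_bounded q : Prop :=
  exists2 r : R, 0 < r &
    asym_ball q 0 1 `<=`
      [set x + y | x in asym_ball (sym_norm q) 0 r & y in theta q].

End AsymNorm.

(* A copy of V that carries, besides its linear structure, the topology
   generated by the balls [asym_ball q x e].  It makes sense for any q, so
   that it also applies to the asymmetric seminorm of a quotient. *)
Definition asym_space {R : realType} {V : lmodType R} (q : V -> R) : Type := V.

Section AsymSpace.
Context {R : realType} {V : lmodType R} (q : V -> R).

HB.instance Definition _ := GRing.Lmodule.on (asym_space q).

HB.instance Definition _ := @isSubBaseTopological.Build (asym_space q)
  (set V) [set B | exists x e, 0 < e /\ B = asym_ball q x e] id.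

End AsymSpace.

Definition lin_homeomorphic {R : realType} (E F : preTopologicalLmodType R) :
    Prop :=
  exists (f : {linear E -> F}) (g : F -> E),
    [/\ cancel f g, cancel g f, continuous f & continuous g].

(* The topology on ['rV[R]_k] is that of the sup norm. *)
Definition euclidean {R : realType} (E : preTopologicalLmodType R) : Prop :=
  exists k : nat, lin_homeomorphic E ('rV[R]_k : normedModType R).

Definition prod_norm {R : realType} {X1 X2 : lmodType R}
    (q1 : X1 -> R) (q2 : X2 -> R) (x : X1 * X2) : R :=
  Num.max (q1 x.1) (q2 x.2).

Section Span.
Context {R : realType} {X : vectType R}.
Implicit Types (A : set X) (U : {vspace X}).

Definition is_span A U : Prop := (forall x, A x -> x \in U) /\
  (forall W : {vspace X}, (forall x, A x -> x \in W) -> (U <= W)%VS).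

(* The library only spans finite sequences; [span_setP] below gives the
   description by finite linear combinations. *)
Definition span_set A : {vspace X} := xget fullv [set U | is_span A U].

Lemma span_set_seq A : exists s : seq X,
  (forall x, x \in s -> A x) /\ is_span A (span s).
Proof.
pose P n := `[< exists s : seq X,
  (forall x, x \in s -> A x) /\ \dim (span s) = n >].
have P0 : exists n, P n.
  by exists 0%N; apply/asboolP; exists [::]; rewrite span_nil dimv0.
have Pub n : P n -> (n <= \dim {:X})%N.
  by move=> /asboolP[s [_ <-]]; apply/dimvS/subvf.
case: (ex_maxnP P0 Pub) => n /asboolP[s [sA sn]] maxn.
exists s; split=> //; split=> [x Ax|W AW]; last by apply/span_subvP => x /sA /AW.
have sub : ((span s) <= span (x :: s))%VS by apply: sub_span => y; rewrite inE orbC => ->.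
suff -> : (span s) = (span (x :: s)) by apply: memv_span; rewrite inE eqxx.
apply/eqP; rewrite eqEdim sub sn; apply: maxn; apply/asboolP.
exists (x :: s); split=> // y; rewrite inE => /orP[/eqP -> //|]; exact: sA.
Qed.

Lemma span_set_spec A : is_span A (span_set A).
Proof.
rewrite /span_set; case: xgetP => [U _ //|] noU.
by have [s [_ /noU]] := span_set_seq A.
Qed.

Lemma mem_span_set A x : A x -> x \in span_set A.
Proof. by case: (span_set_spec A) => + _; apply. Qed.

Lemma span_set_min A U : (forall x, A x -> x \in U) -> (span_set A <= U)%VS.
Proof. by case: (span_set_spec A) => _; apply. Qed.

Lemma span_setP A x : x \in span_set A <->
  exists2 s : seq X, (forall y, y \in s -> A y) & x \in (span s).
Proof.
split=> [xA|[s sA]]; last first.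
  by apply/subvP/span_subvP => y /sA; exact: mem_span_set.
have [s [sA [As _]]] := span_set_seq A.
by exists s => //; apply: (subvP (span_set_min As)).
Qed.

Definition sub_norm (q : X -> R) (Y : {vspace X}) (x : subvs_of Y) : R :=
  q (vsval x).

End Span.

Arguments sub_norm {R X} q Y x.

Section VQuotient.
Context {R : realType} {X : vectType R} (Y : {vspace X}).

Definition vquot : Type := Quotient.quot (pred_of_vspace Y).

HB.instance Definition _ := GRing.Zmodule.on vquot.

Definition vproj (x : X) : vquot := \pi_(Quotient.quot (pred_of_vspace Y)) x.

Lemma vproj_eq x y : vproj x = vproj y <-> x - y \in Y.
Proof. by rewrite Quotient.idealrBE; split=> [/eqP|/eqP]. Qed.

Lemma vproj_surj (u : vquot) : exists x, vproj x = u.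
Proof. by exists (repr (u : Quotient.quot (pred_of_vspace Y))); exact: reprK. Qed.

Lemma vprojD x y : vproj (x + y) = vproj x + vproj y.
Proof. exact: raddfD. Qed.

Definition vquot_scale (a : R) (u : vquot) : vquot :=
  vproj (a *: repr (u : Quotient.quot (pred_of_vspace Y))).

Lemma vquot_scale_proj a x : vquot_scale a (vproj x) = vproj (a *: x).
Proof.
apply/vproj_eq; rewrite -scalerBr memvZ//.
by apply/vproj_eq; exact: reprK.
Qed.

Lemma vquot_scaleA a b u :
  vquot_scale a (vquot_scale b u) = vquot_scale (a * b) u.
Proof. by have [x <-] := vproj_surj u; rewrite !vquot_scale_proj scalerA. Qed.

Lemma vquot_scale1 : left_id 1 vquot_scale.
Proof. by move=> u; have [x <-] := vproj_surj u; rewrite vquot_scale_proj scale1r. Qed.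

Lemma vquot_scaleDr : right_distributive vquot_scale +%R.
Proof.
move=> a u v; have [x <-] := vproj_surj u; have [y <-] := vproj_surj v.
by rewrite -vprojD !vquot_scale_proj -vprojD scalerDr.
Qed.

Lemma vquot_scaleDl u : {morph vquot_scale^~ u : a b / a + b}.
Proof.
move=> a b; have [x <-] := vproj_surj u.
by rewrite !vquot_scale_proj -vprojD scalerDl.
Qed.

HB.instance Definition _ :=
  GRing.Zmodule_isLmodule.Build R vquot
    vquot_scaleA vquot_scale1 vquot_scaleDr vquot_scaleDl.

Lemma vprojZ a x : vproj (a *: x) = a *: vproj x.
Proof. by rewrite -vquot_scale_proj. Qed.

Definition quot_norm (q : X -> R) (u : vquot) : R :=
  inf [set q x | x in [set x | vproj x = u]].

Lemma quot_normE q x :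
  quot_norm q (vproj x) = inf [set q (x + y) | y in [set` Y]].
Proof.
congr inf; apply/seteqP; split=> _ [y /= yP <-].
  exists (y - x); last by rewrite addrC subrK.
  by apply/vproj_eq.
by exists (x + y) => //; apply/vproj_eq; rewrite addrC addKr.
Qed.

End VQuotient.

Arguments quot_norm {R X} Y q u.

(* Main.v *)
(* Any linear complement Z of S = <theta_q> works.  By right-boundedness,
   q x < e implies x = u + t with t in theta_q and q^s(u) < r e.  A linear map
   that kills theta_q only sees the part u, and linear maps are bounded for the
   norm q^s since X is finite-dimensional; hence such a map is bounded for q.
   Applying this to the projection pi onto Z along S gives q(pi x) <= C q(x)
   and q(- pi x) <= D q(x).  The second bound controls the other projection
   x - pi x and shows that q and q^s are equivalent on Z; the first one, taken
   over all representatives of a class, compares q on Z with the quotient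
   seminorm. *)

From HB Require Import structures.
Require Import Defs.
From mathcomp Require Import all_boot all_order all_algebra finmap.
From mathcomp Require Import all_classical all_reals all_analysis.

Set Implicit Arguments.
Unset Strict Implicit.
Unset Printing Implicit Defensive.

Import Order.TTheory GRing.Theory Num.Theory.
Import numFieldNormedType.Exports VectorInternalTheory.

Local Open Scope classical_set_scope.
Local Open Scope ring_scope.

(** * Topologies given by one-sided balls *)

(** This covers asymmetric spaces, quotients and normed spaces alike, so that continuity of linear
    maps between them reduces to inequalities. *)
Definition gauged_by {R : realType} {E : preTopologicalLmodType R}
    (p : E -> R) : Prop :=
  forall (x : E) (A : set E),
    nbhs x A <-> exists2 e : R, 0 < e & asym_ball p x e `<=` A.

Lemma gauged_continuous (R : realType) (E F : preTopologicalLmodType R)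
    (p : E -> R) (p' : F -> R) (f : E -> F) (C : R) :
  gauged_by p -> gauged_by p' -> linear f -> 0 < C ->
  (forall x, p' (f x) <= C * p x) -> continuous f.
Proof.
move=> gp gp' lf C0 fC x A /gp'[e e0 eA]; apply/gp.
exists (C^-1 * e) => [|y /= pyx]; first by rewrite mulr_gt0 ?invr_gt0.
apply: eA; have -> : f y = f (y - x) + f x.
  by rewrite -{1}(subrK x y) -{1}(scale1r (y - x)) lf scale1r.
rewrite /asym_ball /= addrK (le_lt_trans (fC _))//.
by rewrite -ltr_pdivlMl.
Qed.

(** All three homeomorphisms of the theorem are obtained from this criterion: an explicit inverse
    and one bound in each direction. *)
Lemma lin_homeomorphic_bounds (R : realType) (E F : preTopologicalLmodType R)
    (p : E -> R) (p' : F -> R) (f : E -> F) (g : F -> E) (C D : R) :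
  gauged_by p -> gauged_by p' -> linear f -> cancel f g -> cancel g f ->
  0 < C -> 0 < D ->
  (forall x, p' (f x) <= C * p x) -> (forall y, p (g y) <= D * p' y) ->
  lin_homeomorphic E F.
Proof.
move=> gp gp' lf fK gK C0 D0 fC gD.
have lg : linear g by move=> a x y; apply: (can_inj fK); rewrite lf !gK.
pose L := GRing.isLinear.Build R E F _ f lf.
pose fl : {linear E -> F} := HB.pack f L.
exists fl, g; split=> //; first exact: gauged_continuous fC.
exact: gauged_continuous gD.
Qed.

(** * Sublinear functionals *)

Record sublinear {R : realType} {V : lmodType R} (p : V -> R) : Prop := Sublinear {
  sublinearZ : forall a x, 0 <= a -> p (a *: x) = a * p x;
  sublinearD : forall x y, p (x + y) <= p x + p y }.

Section Sublinear.
Context {R : realType} {V : lmodType R}.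

Lemma sublinear0 (p : V -> R) : sublinear p -> p 0 = 0.
Proof. by case=> pZ _; rewrite -(scale0r 0) pZ ?mul0r. Qed.

Lemma asym_norm_sublinear (q : V -> R) : asym_norm q -> sublinear q.
Proof. by case. Qed.

Lemma sublinear_comp (W : lmodType R) (f : {linear W -> V}) (p : V -> R) :
  sublinear p -> sublinear (p \o f).
Proof.
case=> pZ pD; split=> [a x a0|x y] /=; first by rewrite linearZ pZ.
by rewrite linearD pD.
Qed.

Lemma sublinear_opp (p : V -> R) : sublinear p -> sublinear (fun x => p (- x)).
Proof. exact: (@sublinear_comp _ -%R). Qed.

Lemma sublinear_max (p1 p2 : V -> R) : sublinear p1 -> sublinear p2 ->
  sublinear (fun x => Num.max (p1 x) (p2 x)).
Proof.
case=> p1Z p1D [p2Z p2D]; split=> [a x a0|x y].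
  by rewrite p1Z// p2Z// maxr_pMr.
rewrite ge_max (le_trans (p1D x y))/= ?(le_trans (p2D x y)) ?lerD//;
by rewrite le_max lexx ?orbT.
Qed.

(** The balls are only a subbase, with arbitrary centres. By the triangle inequality a ball
    containing [x] contains a ball centred at [x], and a finite intersection is handled by the least
    radius. *)
Lemma gauged_asym_space (p : V -> R) :
  p 0 = 0 -> (forall x y, p (x + y) <= p x + p y) ->
  gauged_by (p : asym_space p -> R).
Proof.
move=> p0 pD x A; split=> [|[e e0 eA]].
  rewrite nbhsE => -[B [[D' sD' <-]] [B0 D'B0 B0x] BA].
  have [I sI IB0] := sD' _ D'B0.
  suff [e e0 eB0] : exists2 e : R, 0 < e & asym_ball p x e `<=` B0.
    by exists e => // y /eB0 B0y; apply: BA; exists B0.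
  have ballP i : i \in I ->
      exists2 e : R, 0 < e & asym_ball p x e `<=` (i : set V).
    move=> iI; have := sI i iI; rewrite inE => -[c [d [d0 iE]]].
    have : i x by move: B0x; rewrite -IB0; apply.
    rewrite iE /asym_ball/= => xd.
    exists (d - p (x - c)); first by rewrite subr_gt0.
    move=> y /=; rewrite ltrBrDr; apply: le_lt_trans.
    by rewrite -{1}(subrK x y) -addrA pD.
  (* Induction on the finite family; the empty one gets radius 1. *)
  have : exists2 e : R, 0 < e &
      forall i, i \in enum_fset I -> asym_ball p x e `<=` (i : set V).
    have : {subset enum_fset I <= I} by [].
    elim: (enum_fset I) => [_|i s IH sub]; first by exists 1.
    have [|e e0 es] := IH; first by move=> j js; apply: sub; rewrite inE js orbT.
    have [|d d0 di] := ballP i; first by apply: sub; rewrite inE eqxx.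
    exists (Num.min e d) => [|j]; first by rewrite lt_min e0.
    rewrite inE => /orP[/eqP ->|js] y; rewrite /asym_ball/= lt_min => /andP[ye yd].
      exact: di.
    exact: (es j js).
  by case=> e e0 eI; exists e => // y ye; rewrite -IB0 => i iI; apply: eI ye.
rewrite nbhsE; exists (asym_ball p x e) => //; split.
  exists [set asym_ball p x e]; last by rewrite bigcup_set1.
  move=> _ ->; apply: (@finI_from1 _ _ _ id); first by exists x, e.
by rewrite /asym_ball/= subrr p0.
Qed.

End Sublinear.

Lemma gauged_norm (R : realType) (E : normedModType R) :
  gauged_by (fun x : E => `|x|).
Proof.
move=> x A; have nbhsE := @nbhs_normP R E x A.
split=> [/nbhsE[e e0 eA]|[e e0 eA]]; [|apply/nbhsE]; exists e => // y;
by move=> xy; apply: eA; move: xy; rewrite /asym_ball/= distrC.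
Qed.

(** Expand [x] in the coordinate basis [d]. Since [p] is only positively homogeneous, the sign of
    each coordinate decides whether [p (d i)] or [p (- d i)] enters, so the constant sums both; the
    extra 1 makes it positive. *)
Lemma sublinear_le_norm (R : realType) (X : vectType R) (p : X -> R) :
  sublinear p -> exists2 M : R, 0 < M & forall x, p x <= M * `|v2r x|.
Proof.
move=> sp; pose d i : X := r2v (delta_mx 0 i).
have coord_le (v : 'rV[R]_(dim X)) i : `|v 0 i| <= `|v|.
  rewrite [leRHS]/Num.norm /= mx_normrE; apply/bigmax_geP; right => /=.
  by exists (0, i).
exists (1 + \sum_i (`|p (d i)| + `|p (- d i)|)) => [|x].
  by rewrite ltr_pwDl// sumr_ge0// => i _; rewrite addr_ge0.
rewrite mulrDl mul1r ler_wpDl// -{1}(v2rK x).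
rewrite {1}(row_sum_delta (v2r x)) linear_sum/= mulr_suml.
elim/big_ind2: _ => [|a b c e ha hb|i _]; first by rewrite sublinear0.
  by rewrite (le_trans (sublinearD sp _ _))// lerD.
rewrite linearZ/= -/(d i); set a := v2r x 0 i.
have : p (a *: d i) <= (`|p (d i)| + `|p (- d i)|) * `|a|.
  have [a0|a0] := leP 0 a.
    rewrite sublinearZ// mulrC (ger0_norm a0) ler_wpM2r//.
    by rewrite (le_trans (ler_norm _))// lerDl.
  rewrite -{1}(opprK a) scaleNr -scalerN sublinearZ ?oppr_ge0 ?(ltW a0)//.
  rewrite mulrC (ltr0_norm a0) ler_wpM2r ?oppr_ge0 ?(ltW a0)//.
  by rewrite (le_trans (ler_norm _))// lerDr.
by move/le_trans; apply; rewrite ler_wpM2l ?addr_ge0 ?coord_le.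
Qed.

(** * The symmetrised norm in finite dimension *)

Section SymNorm.
Context {R : realType} {V : lmodType R}.
Variables (q : V -> R) (q_asym : asym_norm q).

Lemma sym_norm_sublinear : sublinear (sym_norm q).
Proof.
apply: sublinear_max; first exact: asym_norm_sublinear.
exact/sublinear_opp/asym_norm_sublinear.
Qed.

Lemma sym_norm_gt0 x : x != 0 -> 0 < sym_norm q x.
Proof.
move=> x0; rewrite lt_max !lt_neqAle !(asym_norm_ge0 q_asym) !andbT -negb_and.
apply: contraNN x0 => /andP[/eqP qx /eqP qNx].
by apply/eqP/(asym_norm_eq0 q_asym).
Qed.

End SymNorm.

Lemma norm_le_sym_norm (R : realType) (X : vectType R) (q : X -> R) :
  asym_norm q ->
  exists2 C : R, 0 < C & forall x, `|v2r x| <= C * sym_norm q x.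
Proof.
(* The symmetrised norm attains a positive minimum on the compact unit sphere. *)
move=> q_asym; have sN := sym_norm_sublinear q_asym.
pose N := sym_norm q; pose h (v : 'rV[R]_(dim X)) := N (r2v v).
have [M M0 NM] := sublinear_le_norm sN.
(* Subadditivity makes [h] Lipschitz, hence continuous. *)
have hB (u v : 'rV[R]_(dim X)) : h u - h v <= M * `|u - v|.
  rewrite lerBlDr -{1}(subrK v u) /h linearD (le_trans (sublinearD sN _ _))//.
  by rewrite lerD2r (le_trans (NM _))// r2vK.
have ch : continuous h.
  move=> v A /nbhs_normP[e e0 eA]; apply/(@nbhs_normP R 'rV[R]_(dim X)).
  exists (M^-1 * e) => [|u vu]; first by rewrite /= mulr_gt0 ?invr_gt0.
  apply: eA; move: vu; rewrite /= ltr_pdivlMl// => vu.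
  by apply: le_lt_trans vu; rewrite ler_norml lerNl opprB !(le_trans (hB _ _))// distrC.
pose S : set 'rV[R]_(dim X) := [set v | `|v| = 1].
have cS : compact S.
  apply: bounded_closed_compact.
    exists 1; split; first exact: num_real.
    by move=> y y1 v /= ->; exact: ltW.
  apply: (closed_comp (f := fun v : 'rV[R]_(dim X) => `|v|) (D := [set 1])).
    by move=> v _; exact: norm_continuous.
  exact: closed_eq.
have v2r_eq0 (x : X) : (v2r x == 0) = (x == 0).
  by rewrite -(inj_eq (can_inj (@v2rK _ X))) linear0.
have normS x : x != 0 -> S (`|v2r x|^-1 *: v2r x).
  move=> x0; rewrite /S/= normrZ normfV normr_id mulVf// normr_eq0.
  by rewrite v2r_eq0.
(* If the sphere is empty then every vector is zero, and any constant serves. *)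
have [S0|S0] := pselect (S !=set0); last first.
  exists 1 => // x; have [->|x0] := eqVneq x 0.
    by rewrite linear0 normr0 sublinear0 ?mulr0.
  by case: S0; exists (`|v2r x|^-1 *: v2r x); exact: normS.
have [c cS1 cmin] := EVT_min_rV S0 cS (continuous_subspaceT ch).
have c0 : 0 < h c.
  apply: sym_norm_gt0 => //; apply: contraTN cS1 => /eqP c0.
  by rewrite notin_setE /S/= -(r2vK c) c0 linear0 normr0 => /esym/eqP; rewrite oner_eq0.
exists (h c)^-1 => [|x]; first by rewrite invr_gt0.
have [->|x0] := eqVneq x 0.
  by rewrite linear0 normr0 sublinear0 ?mulr0.
have nx0 : 0 < `|v2r x|.
  by rewrite normr_gt0 v2r_eq0.
rewrite ler_pdivlMl// mulrC -ler_pdivlMl//.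
rewrite -sublinearZ ?invr_ge0//; have := cmin _ (mem_set (normS x x0)).
by rewrite /h linearZ/= v2rK.
Qed.

(** * Consequences of right-boundedness *)

(** Rescale [x] by [1/e] into the unit ball, split it there, and scale both pieces back; [e] is
    positive because [0 <= q x < e]. *)
Lemma right_bounded_decomp (R : realType) (X : lmodType R) (q : X -> R) :
  asym_norm q -> right_bounded q ->
  exists2 r : R, 0 < r & forall x e, q x < e ->
    exists u t, [/\ x = u + t, theta q t & sym_norm q u < r * e].
Proof.
move=> q_asym [r r0 rb]; exists r => // x e xe.
have e0 : 0 < e by apply: le_lt_trans xe; exact: asym_norm_ge0.
have [|u ur [t tq utE]] := rb (e^-1 *: x).
  rewrite /asym_ball/= subr0 (asym_normZ q_asym) ?invr_ge0 ?ltW//.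
  by rewrite ltr_pdivrMl// mulr1.
exists (e *: u), (e *: t); split.
- by rewrite -scalerDr utE scalerA divff ?scale1r// gt_eqF.
- by rewrite /theta/= (asym_normZ q_asym) ?ltW// tq mulr0.
- move: ur; rewrite /asym_ball/= subr0 => ur.
  by rewrite (sublinearZ (sym_norm_sublinear q_asym)) ?ltW// mulrC ltr_pM2r.
Qed.

Lemma right_bounded_lin (R : realType) (X Y : vectType R) (q : X -> R)
    (p : Y -> R) (f : {linear X -> Y}) :
  asym_norm q -> right_bounded q -> sublinear p ->
  (forall t, theta q t -> f t = 0) ->
  exists2 C : R, 0 < C & forall x, p (f x) <= C * q x.
Proof.
move=> q_asym q_rb sp f0.
have [r r0 dec] := right_bounded_decomp q_asym q_rb.
have [M M0 pM] := sublinear_le_norm (sublinear_comp f sp).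
have [C C0 NC] := norm_le_sym_norm q_asym.
exists (M * (C * r)) => [|x]; first by rewrite !mulr_gt0.
(* The decomposition needs a strict bound on [q x], so it is applied with [e + q x] for arbitrary
   [e > 0]. *)
rewrite -ler_pdivrMl ?mulr_gt0//; apply/ler_addgt0Pl => e e0.
have [|u [t [xE tq ue]]] := dec x (e + q x); first by rewrite ltrDr.
rewrite ler_pdivrMl ?mulr_gt0// {1}xE linearD (f0 t)// addr0.
rewrite (le_trans (pM _))// -mulrA ler_wpM2l ?(ltW M0)// (le_trans (NC _))//.
by rewrite -mulrA ler_wpM2l ?(ltW C0)// ltW.
Qed.

(** * The quotient seminorm *)

Section QuotNorm.
Context {R : realType} {X : vectType R} (Y : {vspace X}).
Variables (q : X -> R) (q_asym : asym_norm q).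

Let fibre_neq0 (u : vquot Y) : [set q x | x in [set x | vproj Y x = u]] !=set0.
Proof. by have [x xu] := vproj_surj u; exists (q x), x. Qed.

Lemma quot_norm_le x : quot_norm Y q (vproj Y x) <= q x.
Proof.
apply: ge_inf; last by exists x.
by exists 0 => _ [y _ <-]; exact: asym_norm_ge0.
Qed.

Lemma quot_norm_lb u c :
  (forall x, vproj Y x = u -> c <= q x) -> c <= quot_norm Y q u.
Proof. by move=> cq; apply: lb_le_inf => // _ [x xu <-]; exact: cq. Qed.

Lemma quot_norm0 : quot_norm Y q 0 = 0.
Proof.
have v0 : vproj Y 0 = 0 by apply: (addrI (vproj Y 0)); rewrite -vprojD !addr0.
apply/eqP; rewrite eq_le quot_norm_lb ?andbT => [|x _]; last exact: asym_norm_ge0.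
rewrite -v0 (le_trans (quot_norm_le 0))// sublinear0//.
exact: asym_norm_sublinear.
Qed.

Lemma quot_normD u v : quot_norm Y q (u + v) <= quot_norm Y q u + quot_norm Y q v.
Proof.
(* The infima over representatives of [u] and of [v] are removed one after the other. *)
rewrite -lerBlDr; apply: quot_norm_lb => a <-.
rewrite lerBlDr -lerBlDl; apply: quot_norm_lb => b <-.
by rewrite lerBlDl -vprojD (le_trans (quot_norm_le _)) ?asym_normD.
Qed.

End QuotNorm.

(** * Subspaces, products and the final splitting *)

Lemma asym_norm_sub (R : realType) (X : vectType R) (q : X -> R)
    (Y : {vspace X}) : asym_norm q -> asym_norm (sub_norm q Y).
Proof.
move=> [q0 qZ qD qE]; split=> [x|a x a0|x y|x xq xNq]; rewrite /sub_norm.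
- exact: q0.
- by rewrite linearZ qZ.
- by rewrite linearD qD.
- by apply: val_inj; apply: qE => //; rewrite -linearN.
Qed.

Lemma gauged_asym_norm (R : realType) (V : lmodType R) (q : V -> R) :
  asym_norm q -> gauged_by (q : asym_space q -> R).
Proof.
move=> q_asym; have sq := asym_norm_sublinear q_asym.
by apply: gauged_asym_space; [exact: sublinear0|exact: sublinearD].
Qed.

Lemma gauged_prod_norm (R : realType) (V W : lmodType R) (q1 : V -> R)
    (q2 : W -> R) : asym_norm q1 -> asym_norm q2 ->
  gauged_by (prod_norm q1 q2 : asym_space (prod_norm q1 q2) -> R).
Proof.
move=> /asym_norm_sublinear s1 /asym_norm_sublinear s2.
apply: gauged_asym_space => [|x y].
  by rewrite /prod_norm (sublinear0 s1) (sublinear0 s2) maxxx.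
rewrite /prod_norm/= ge_max (le_trans (sublinearD s1 _ _)) ?lerD ?le_max ?lexx//=.
by rewrite (le_trans (sublinearD s2 _ _)) ?lerD// le_max lexx orbT.
Qed.

Theorem corollary4p9 (R : realType) (X : vectType R) (q : X -> R)
    (q_asym : asym_norm q) (q_rb : right_bounded q) :
  let S : {vspace X} := span_set (theta q) in
  exists Z : {vspace X},
    [/\ lin_homeomorphic (asym_space q)
          (asym_space (prod_norm (sub_norm q S) (sub_norm q Z))),
        euclidean (asym_space (sub_norm q Z)) &
        lin_homeomorphic (asym_space (sub_norm q Z))
          (asym_space (quot_norm S q))].
Proof.
move=> S; pose Z := (S^C)%VS; exists Z.
have qS_asym := asym_norm_sub S q_asym.
have qZ_asym := asym_norm_sub Z q_asym.
have sZ := asym_norm_sublinear qZ_asym.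
have q_ge0 := asym_norm_ge0 q_asym.
have qZ_ge0 := asym_norm_ge0 qZ_asym.
pose pS : {linear X -> subvs_of S} := vsproj S \o projv S.
pose pZ : {linear X -> subvs_of Z} := vsproj Z \o (\1 - projv S)%VF.
have pSE x : vsval (pS x) = projv S x by rewrite /= vsprojK ?memv_proj.
have pZE x : vsval (pZ x) = x - projv S x.
  by rewrite /= !lfunE/= !lfunE/= vsprojK ?memv_projC.
clearbody pS pZ.
have pS_pZ x : vsval (pS x) + vsval (pZ x) = x by rewrite pSE pZE addrC subrK.
have pZ_S x : x \in S -> pZ x = 0.
  by move=> xS; apply: val_inj; rewrite /= pZE projv_id// subrr.
have pZ_Z (z : subvs_of Z) : pZ (vsval z) = z.
  apply: val_inj; rewrite /= pZE; apply/eqP; rewrite subr_eq addrC -subr_eq subrr.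
  (* Writing the projection of [z] as [z - (z - projv S z)] shows that it also lies in [Z], so it
     vanishes. *)
  have : projv S (vsval z) \in (S :&: Z)%VS.
    rewrite memv_cap memv_proj/= -(subKr (vsval z) (projv S (vsval z))).
    by rewrite memvB ?subvsP ?memv_projC.
  by rewrite capv_compl memv0 eq_sym.
have pZ_theta t : theta q t -> pZ t = 0 by move=> tq; exact/pZ_S/mem_span_set.
have [C C0 qC] := right_bounded_lin q_asym q_rb sZ pZ_theta.
have [D D0 qD] := right_bounded_lin q_asym q_rb (sublinear_opp sZ) pZ_theta.
split.
(* The factor [1 + C + D] dominates both components: [pS x = x - pZ x] costs [1 + D], and [pZ x]
   costs [C]. For [g], a sum is at most twice the maximum. *)
- pose f x := (pS x, pZ x).
  pose g (y : subvs_of S * subvs_of Z) := vsval y.1 + vsval y.2.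
  apply: (@lin_homeomorphic_bounds _ (asym_space q)
    (asym_space (prod_norm (sub_norm q S) (sub_norm q Z))) q
    (prod_norm (sub_norm q S) (sub_norm q Z)) f g (1 + C + D) (1 + 1)).
  + exact: gauged_asym_norm.
  + exact: gauged_prod_norm.
  + by move=> a x y; rewrite /f !linearP.
  + exact: pS_pZ.
  + move=> [s z]; rewrite /g/f/=; congr pair; last first.
      by rewrite linearD pZ_Z pZ_S ?subvsP// add0r.
    apply: val_inj => /=; rewrite pSE linearD/= projv_id ?subvsP//.
    rewrite -[RHS](addr0 (vsval s)); congr (_ + _).
    by rewrite -pSE -[LHS](addrK (vsval z)) -{2}(pZ_Z z) pS_pZ subrr.
  + by rewrite !addr_gt0.
  + exact: addr_gt0.
  + move=> x; rewrite /f /prod_norm /= ge_max; apply/andP; split.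
      have -> : sub_norm q S (pS x) = q (x - vsval (pZ x)).
        by rewrite -{2}(pS_pZ x) addrK.
      rewrite (le_trans (asym_normD q_asym _ _))// -addrA mulrDl mul1r lerD2l.
      rewrite mulrDl ler_wpDl ?mulr_ge0 ?(ltW C0)//.
      by have := qD x; rewrite /sub_norm linearN.
    by rewrite (le_trans (qC x))// ler_wpM2r// addrAC ler_wpDl// addr_ge0// ltW.
  + move=> y; rewrite (le_trans (asym_normD q_asym _ _))// mulrDl mul1r.
    by rewrite lerD// /prod_norm le_max lexx ?orbT.
(* On [Z] the map [pZ] is the identity, so [q (- z) <= D * q z] and the symmetrised norm is at most
   [(1 + D) * q z]; [K] then passes to coordinates. *)
- have [M M0 qM] := sublinear_le_norm sZ.
  have [K K0 qK] := norm_le_sym_norm qZ_asym.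
  exists (dim (subvs_of Z)).
  apply: (@lin_homeomorphic_bounds _ (asym_space (sub_norm q Z))
    ('rV[R]_(dim (subvs_of Z)) : normedModType R) (sub_norm q Z)
    (fun v : 'rV[R]_(dim (subvs_of Z)) => `|v|) v2r r2v (K * (1 + D)) M) => //.
  + exact: gauged_asym_norm.
  + exact: gauged_norm.
  + exact: linearP.
  + exact: v2rK.
  + exact: r2vK.
  + by rewrite mulr_gt0// addr_gt0.
  + move=> z; rewrite (le_trans (qK z))// -mulrA ler_wpM2l ?(ltW K0)//.
    rewrite ge_max mulrDl mul1r lerDl mulr_ge0 ?(ltW D0) ?qZ_ge0//=.
    by rewrite ler_wpDl ?qZ_ge0// -{1}(pZ_Z z); exact: qD.
  + by move=> v; rewrite (le_trans (qM _))// r2vK.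
- pose f (z : subvs_of Z) := vproj S (vsval z).
  (* [pZ] kills [S], so it factors through the quotient, whichever representative is chosen. *)
  have [g gE] : exists g, forall x, g (vproj S x) = pZ x.
    exists (fun u => pZ (projT1 (cid (vproj_surj u)))) => x.
    case: cid => y /= /vproj_eq yx; apply/eqP.
    by rewrite -subr_eq0 -linearB pZ_S.
  apply: (@lin_homeomorphic_bounds _ (asym_space (sub_norm q Z))
    (asym_space (quot_norm S q)) (sub_norm q Z) (quot_norm S q) f g 1 C) => //.
  + exact: gauged_asym_norm.
  + apply: gauged_asym_space; [exact: quot_norm0|exact: quot_normD].
  + by move=> a x y; rewrite /f linearP vprojD vprojZ.
  + by move=> z; rewrite /f gE pZ_Z.
  + move=> u; have [x <-] := vproj_surj u; rewrite gE /f; apply/vproj_eq.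
    by rewrite pZE addrAC subrr add0r memvN memv_proj.
  + by move=> z; rewrite mul1r quot_norm_le.
  (* The bound [qC] holds for every representative [x] of [u], hence for the infimum. *)
  + move=> u; rewrite -ler_pdivrMl//; apply: quot_norm_lb => x <-.
    by rewrite gE ler_pdivrMl.
Qed.
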